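(* Consider an admixture model $\pi_{\boldsymbol\theta}=\sum_{k=1}^K\theta_k\boldsymbol\beta_k$, $\boldsymbol\theta\in\Delta^{K-1}$, where each $\boldsymbol\beta_k=(\beta_{kv})_{v\in\widetilde{\mathcal V}}$ is a probability distribution on $\widetilde{\mathcal V}$. Define $q_k=\beta_{k\dashv}$ and $s_k=\sum_{w\in\mathcal V}\beta_{kw}\,\mathrm{syl}(w)$, and $\mathbf q=(q_k)_k,\ \mathbf s=(s_k)_k\in\mathbb R^K$. Then $e(\boldsymbol\theta)=\mathbf q^\top\boldsymbol\theta$ and $\sigma(\boldsymbol\theta)=\mathbf s^\top\boldsymbol\theta$; and, writing $\mathcal D=\{\boldsymbol\theta\in\Delta^{K-1}:0<\mathbf q^\top\boldsymbol\theta<1\}$ for the set on which $\Phi$ is defined, for every $\boldsymbol\theta\in\mathcal D$ $$\Phi(\boldsymbol\theta)=a\,\frac{1-\mathbf q^\top\boldsymbol\theta}{\mathbf q^\top\boldsymbol\theta}+b\,\frac{\mathbf s^\top\boldsymbol\theta}{1-\mathbf q^\top\boldsymbol\theta}+c .$$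
   Context: $\mathcal V$ is a finite word vocabulary, $\dashv$ is a sentence-boundary token, and $\widetilde{\mathcal V}=\mathcal V\cup\{\dashv\}$. $\mathrm{syl}:\mathcal V\to[1,s_{\max}]$ is a fixed bounded real-valued syllable count, extended by $\mathrm{syl}(\dashv)=0$. $\Delta^{K-1}$ is the probability simplex in $\mathbb R^K$. For a family of distributions $\pi_{\boldsymbol\theta}$ on $\widetilde{\mathcal V}$ define $e(\boldsymbol\theta)=\pi_{\boldsymbol\theta}(\dashv)$, $\sigma(\boldsymbol\theta)=\sum_{w\in\mathcal V}\pi_{\boldsymbol\theta}(w)\,\mathrm{syl}(w)$ and, when $0<e(\boldsymbol\theta)<1$, $\Phi(\boldsymbol\theta)=a\frac{1-e(\boldsymbol\theta)}{e(\boldsymbol\theta)}+b\frac{\sigma(\boldsymbol\theta)}{1-e(\boldsymbol\theta)}+c$. The coefficients $(a,b,c)$ are fixed: $(0.39,11.8,-15.59)$ (Flesch–Kincaid Grade Level) or $(-1.015,-84.6,206.835)$ (Flesch Reading Ease). *)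

(* Defs.v *)
From HB Require Import structures.
From mathcomp Require Import all_boot all_order all_algebra.
From mathcomp Require Import reals.

Set Implicit Arguments.
Unset Strict Implicit.
Unset Printing Implicit Defensive.

Import Order.TTheory GRing.Theory Num.Theory.
Local Open Scope ring_scope.

(* The extended vocabulary is [option V]: [Some w] is the word [w] and [None]
   is the sentence-boundary token. *)
Record token_distr (R : realType) (V : finType) := TokenDistr {
  prob :> option V -> R;
  prob_ge0 : forall v, 0 <= prob v;
  prob_sum1 : \sum_(v : option V) prob v = 1 }.

(* The probability simplex in R^K, of dimension K - 1; it is empty for
   K = 0. *)
Record simplex (R : realType) (K : nat) := Simplex {
  weights :> 'cV[R]_K;
  weights_ge0 : forall k, 0 <= weights k 0;
  weights_sum1 : \sum_(k < K) weights k 0 = 1 }.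

Definition dot (R : realType) (K : nat) (u v : 'cV[R]_K) : R :=
  (u^T *m v) 0 0.

Section Readability.
Variables (R : realType) (V : finType) (syl : option V -> R).
Variables (Theta : Type) (pi : Theta -> token_distr R V).

Definition end_prob (theta : Theta) : R := pi theta None.

Definition mean_syl (theta : Theta) : R :=
  \sum_(w : V) pi theta (Some w) * syl (Some w).

(* [Phi] is a partial function: it has no value unless 0 < e(theta) < 1. *)
Definition Phi (a b c : R) (theta : Theta) : option R :=
  let e := end_prob theta in
  if 0 < e < 1
  then Some (a * ((1 - e) / e) + b * (mean_syl theta / (1 - e)) + c)
  else None.

End Readability.

(* Flesch-Kincaid Grade Level: (0.39, 11.8, -15.59). *)
Definition fkgl_coef (R : realType) : R * R * R :=
  (39 / 100, 118 / 10, - (1559 / 100)).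

(* Flesch Reading Ease: (-1.015, -84.6, 206.835). *)
Definition fre_coef (R : realType) : R * R * R :=
  (- (1015 / 1000), - (846 / 10), 206 + 835 / 1000).

Section Admixture.
Variables (R : realType) (V : finType) (K : nat).
Variable beta : 'I_K -> token_distr R V.

Definition admix_prob (theta : simplex R K) (v : option V) : R :=
  \sum_(k < K) theta k 0 * beta k v.

Lemma admix_prob_ge0 theta v : 0 <= admix_prob theta v.
Proof.
by apply: sumr_ge0 => k _; rewrite mulr_ge0 ?weights_ge0 ?prob_ge0.
Qed.

Lemma admix_prob_sum1 theta : \sum_(v : option V) admix_prob theta v = 1.
Proof.
rewrite exchange_big /= -[RHS](weights_sum1 theta); apply: eq_bigr => k _.
by rewrite -mulr_sumr prob_sum1 mulr1.
Qed.

Definition admixture (theta : simplex R K) : token_distr R V :=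
  TokenDistr (admix_prob_ge0 theta) (admix_prob_sum1 theta).

Definition topic_end : 'cV[R]_K := \col_k beta k None.

Definition topic_syl (syl : option V -> R) : 'cV[R]_K :=
  \col_k \sum_(w : V) beta k (Some w) * syl (Some w).

End Admixture.

(* Main.v *)
Require Import Defs.
From HB Require Import structures.
From mathcomp Require Import all_boot all_order all_algebra.
From mathcomp Require Import reals.
Import Order.TTheory GRing.Theory Num.Theory.
Local Open Scope ring_scope.

(** The end probability and the mean syllable count are linear functionals of the token
    distribution, and the mixture is linear in its weights. Each is therefore a linear form in
    [theta] whose coefficients are its values on the topics: [end_prob_admixture] and
    [mean_syl_admixture]. Since [Phi] sees the distribution only through these two numbers, its
    domain and its formula follow by substitution. *)

Lemma dotE (R : realType) (K : nat) (u v : 'cV[R]_K) :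
  dot u v = \sum_(k < K) u k 0 * v k 0.
Proof. by rewrite /dot mxE; apply: eq_bigr => k _; rewrite mxE. Qed.

Lemma end_prob_admixture (R : realType) (V : finType) (K : nat)
    (beta : 'I_K -> token_distr R V) (theta : simplex R K) :
  end_prob (admixture beta) theta = dot (topic_end beta) theta.
Proof. by rewrite dotE; apply: eq_bigr => k _; rewrite mxE mulrC. Qed.

Lemma mean_syl_admixture (R : realType) (V : finType) (syl : option V -> R)
    (K : nat) (beta : 'I_K -> token_distr R V) (theta : simplex R K) :
  mean_syl syl (admixture beta) theta = dot (topic_syl beta syl) theta.
Proof.
rewrite dotE /mean_syl /= /admix_prob.
under eq_bigr do rewrite mulr_suml.
(* With the topic sum outermost, the weight of topic [k] is constant in the inner sum over words and
   factors out, leaving [s_k]. *)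
rewrite exchange_big /=; apply: eq_bigr => k _.
by rewrite mxE mulr_suml; apply: eq_bigr => w _; rewrite -mulrA mulrC.
Qed.

Theorem corollary4 (R : realType) (V : finType) (smax : R)
    (syl : option V -> R)
    (syl_bounds : forall w : V, 1 <= syl (Some w) <= smax)
    (syl_end : syl None = 0)
    (a b c : R)
    (abc : (a, b, c) = fkgl_coef R \/ (a, b, c) = fre_coef R)
    (K : nat) (beta : 'I_K -> token_distr R V) :
  let pi := admixture beta in
  let q := topic_end beta in
  let s := topic_syl beta syl in
  (forall theta : simplex R K,
     end_prob pi theta = dot q theta /\
     mean_syl syl pi theta = dot s theta) /\
  (forall theta : simplex R K,
     Phi syl pi a b c theta <> None <-> 0 < dot q theta < 1) /\
  (forall theta : simplex R K,
     0 < dot q theta < 1 ->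
     Phi syl pi a b c theta =
       Some (a * ((1 - dot q theta) / dot q theta)
             + b * (dot s theta / (1 - dot q theta)) + c)).
Proof.
move=> pi q s; split; [|split] => theta.
- by split; [exact: end_prob_admixture | exact: mean_syl_admixture].
(* After the rewrite, the guard of [Phi] is literally the condition on [dot q theta]. *)
- by rewrite /Phi end_prob_admixture; case: ifP.
- by move=> e01; rewrite /Phi end_prob_admixture mean_syl_admixture e01.
Qed.
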